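(* A realiser for $\mathrm{MCT}^1_{\mathrm{net}}$ computes $\exists^4$ via a term of G\''odel's $T$, and vice versa. That is, there is a term $t$ of G\''odel's $T$ such that for every realiser $\Phi$ for $\mathrm{MCT}^1_{\mathrm{net}}$, $t(\Phi)$ is the functional $\exists^4$; and there is a term $s$ of G\''odel's $T$ such that $s(\exists^4)$ is a realiser for $\mathrm{MCT}^1_{\mathrm{net}}$.
   Context: Finite types: $0$ is the type of natural numbers, $\sigma\to\tau$ the type of mappings from type $\sigma$ to type $\tau$ objects, $1:=0\to0$, $n+1:=n\to0$; superscripts denote types. G\''odel's $T$ is the system of (higher-order) primitive recursive functionals of finite type: its terms are the closed terms built from zero, successor, the combinators ($\lambda$-abstraction) and primitive recursors of all finite types. The functional $\exists^4$ is $E^{(2\to0)\to0}$ such that for all $Y^{2\to0}$: $E(Y)=_00\leftrightarrow(\exists f^2)(Y(f)=0)$. Reals are represented by type 1 objects, namely sequences of rationals $(q_n)$ with $|q_n-q_{n+i}|<2^{-n}$ for all $n,i$; equality of reals is $|q_n-r_n|\le2^{-n+1}$ for all $n$. A subset $E$ of $\mathbb{N}^{\mathbb{N}}\to\mathbb{N}$ (the type 2 objects) is given by a characteristic function $F_E^3\le_31$, with $Y\in E$ meaning $F_E(Y)=1$ for $Y^2$; a binary relation $\preceq$ on $E$ is given by a characteristic function of type $(2\times2)\to0$. $(E,\preceq)$ with $E\ne\emptyset$ is directed if $\preceq$ is transitive and reflexive on $E$ and any two elements $x,y$ of $E$ have some $z\in E$ with $x\preceq z$, $y\preceq z$. A net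 in $[0,1]$ is a map $x_e:E\to[0,1]$ with $(E,\preceq)$ directed; it is increasing if $a\preceq b$ implies $x_a\le x_b$ for $a,b\in E$; it converges to $x$, written $\lim_ex_e=x$, if $(\forall\varepsilon>0)(\exists e_0\in E)(\forall e\succeq e_0)(|x_e-x|<\varepsilon)$. $\mathrm{MCT}^1_{\mathrm{net}}$ is the statement that any increasing net $x_e:E\to[0,1]$ indexed by a subset $E$ of $\mathbb{N}^{\mathbb{N}}\to\mathbb{N}$ converges to a limit in $[0,1]$. A realiser for $\mathrm{MCT}^1_{\mathrm{net}}$ is a functional that takes as input $(E,\preceq_E,x_e)$ and outputs the real $x=_{\mathbb{R}}\lim_ex_e$ whenever the inputs satisfy the conditions of $\mathrm{MCT}^1_{\mathrm{net}}$. *)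

(* Defs.v *)
From mathcomp Require Import all_boot all_order all_algebra.
From Stdlib Require Cantor.

Set Implicit Arguments.
Unset Strict Implicit.
Unset Printing Implicit Defensive.
Import Order.TTheory GRing.Theory Num.Theory.

Declare Scope fty_scope.
Delimit Scope fty_scope with fty.

Inductive fty : Type :=
| Nat : fty
| Arrow : fty -> fty -> fty.

Bind Scope fty_scope with fty.
Notation "s ~> t" := (Arrow s t) (at level 55, right associativity) : fty_scope.

(* The pure types: [pure 0] is [Nat] and [pure n.+1] is [pure n ~> Nat]. *)
Fixpoint pure (n : nat) : fty :=
  if n is m.+1 then (pure m ~> Nat)%fty else Nat.

(* The full type structure over the natural numbers. *)
Fixpoint obj (s : fty) : Type :=
  match s with
  | Nat => nat
  | Arrow s t => obj s -> obj t
  end.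

(* Goedel's T, presented with lambda-abstraction. Terms are intrinsically
   typed: [var G s] is the type of de Bruijn indices of type [s] in the
   context [G], and [term G s] that of the terms of type [s] over [G]. *)
Inductive var : seq fty -> fty -> Type :=
| VZ G s : var (s :: G) s
| VS G s r : var G s -> var (r :: G) s.

Inductive term : seq fty -> fty -> Type :=
| Var G s : var G s -> term G s
| Lam G s t : term (s :: G) t -> term G (s ~> t)
| App G s t : term G (s ~> t) -> term G s -> term G t
| Zero G : term G Nat
| Succ G : term G (Nat ~> Nat)
| Rec G s : term G (s ~> (Nat ~> s ~> s) ~> Nat ~> s).

Fixpoint env (G : seq fty) : Type :=
  match G with
  | [::] => unit
  | s :: G => (obj s * env G)%type
  end.

Fixpoint lookup G s (v : var G s) : env G -> obj s :=
  match v in var G s return env G -> obj s with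
  | VZ _ _ => fun rho => rho.1
  | VS _ _ _ v => fun rho => lookup v rho.2
  end.

(* [Rec] is interpreted by the recursor satisfying
     R a f 0 = a   and   R a f n.+1 = f n (R a f n). *)
Fixpoint eval G s (t : term G s) : env G -> obj s :=
  match t in term G s return env G -> obj s with
  | Var _ _ v => fun rho => lookup v rho
  | Lam _ _ _ b => fun rho x => eval b (x, rho)
  | App _ _ _ f a => fun rho => (eval f rho) (eval a rho)
  | Zero _ => fun=> 0%N
  | Succ _ => fun=> S
  | Rec _ s => fun=> fun a f n => nat_rect (fun=> obj s) a f n
  end.

Notation closed_term s := (term [::] s).

Definition value s (t : closed_term s) : obj s := eval t tt.

Definition is_exists4 (E : obj (pure 4)) : Prop :=
  forall Y : obj (pure 3), E Y = 0%N <-> exists f : obj (pure 2), Y f = 0%N.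

Local Open Scope ring_scope.

(* Every natural number codes a rational: if [Cantor.of_nat c = (a, b)] then
   [c] codes (a/2)/(b+1) when [a] is even and -((a+1)/2)/(b+1) when [a] is
   odd. *)
Definition rat_of_code (c : nat) : rat :=
  let: (a, b) := Cantor.of_nat c in
  (if odd a then - (uphalf a)%:R else (a./2)%:R) / b.+1%:R.

Definition rat_seq (f : obj (pure 1)) : nat -> rat :=
  fun n => rat_of_code (f n).

Definition is_real (q : nat -> rat) : Prop :=
  forall n i : nat, `|q n - q (n + i)%N| < 2 ^- n.

(* On reals, [real_le q r] and [real_le r q] together say
   |q_n - r_n| <= 2^(-n+1) for all n, which is equality of reals; [real_lt q r]
   is the negation of [real_le r q]. *)
Definition real_le (q r : nat -> rat) : Prop :=
  forall n : nat, q n <= r n + 2 / 2 ^+ n.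

Definition real_lt (q r : nat -> rat) : Prop :=
  exists n : nat, r n > q n + 2 / 2 ^+ n.

Definition real_rat (a : rat) : nat -> rat := fun=> a.

(* The index shift makes the difference of two reals satisfy [is_real]. *)
Definition real_sub (q r : nat -> rat) : nat -> rat :=
  fun n => q n.+1 - r n.+1.

Definition real_abs (q : nat -> rat) : nat -> rat := fun n => `|q n|.

Definition in_unit_interval (q : nat -> rat) : Prop :=
  [/\ is_real q, real_le (real_rat 0) q & real_le q (real_rat 1)].

Definition in_set (F : obj (pure 3)) (a : obj (pure 2)) : Prop := F a = 1%N.

Definition in_rel (P : obj (pure 2 ~> pure 2 ~> pure 0)) (a b : obj (pure 2)) :
  Prop := P a b = 1%N.

Definition characteristic (F : obj (pure 3))
    (P : obj (pure 2 ~> pure 2 ~> pure 0)) : Prop :=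
  (forall a, (F a <= 1)%N) /\ (forall a b, (P a b <= 1)%N).

Definition directed (F : obj (pure 3))
    (P : obj (pure 2 ~> pure 2 ~> pure 0)) : Prop :=
  [/\ exists a, in_set F a,
      forall a b c, in_set F a -> in_set F b -> in_set F c ->
        in_rel P a b -> in_rel P b c -> in_rel P a c,
      forall a, in_set F a -> in_rel P a a
    & forall a b, in_set F a -> in_set F b ->
        exists c, [/\ in_set F c, in_rel P a c & in_rel P b c]].

(* A net is given by a total map [x], whose values matter only on the index
   set. *)
Definition net_in_unit_interval (F : obj (pure 3))
    (P : obj (pure 2 ~> pure 2 ~> pure 0)) (x : obj (pure 2 ~> pure 1)) : Prop :=
  [/\ characteristic F P, directed F P
    & forall a, in_set F a -> in_unit_interval (rat_seq (x a))].

Definition increasing (F : obj (pure 3))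
    (P : obj (pure 2 ~> pure 2 ~> pure 0)) (x : obj (pure 2 ~> pure 1)) : Prop :=
  forall a b, in_set F a -> in_set F b -> in_rel P a b ->
    real_le (rat_seq (x a)) (rat_seq (x b)).

Definition converges_to (F : obj (pure 3))
    (P : obj (pure 2 ~> pure 2 ~> pure 0)) (x : obj (pure 2 ~> pure 1))
    (y : obj (pure 1)) : Prop :=
  forall eps : obj (pure 1),
    is_real (rat_seq eps) -> real_lt (real_rat 0) (rat_seq eps) ->
    exists2 e0, in_set F e0 &
      forall e, in_set F e -> in_rel P e0 e ->
        real_lt (real_abs (real_sub (rat_seq (x e)) (rat_seq y))) (rat_seq eps).

(* Curried inputs: characteristic functions of the index set and of the
   relation, and the net. *)
Definition mct_type : fty :=
  (pure 3 ~> (pure 2 ~> pure 2 ~> pure 0) ~> (pure 2 ~> pure 1) ~> pure 1)%fty.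

Definition mct_net1_realiser (Phi : obj mct_type) : Prop :=
  forall (F : obj (pure 3)) (P : obj (pure 2 ~> pure 2 ~> pure 0))
         (x : obj (pure 2 ~> pure 1)),
    net_in_unit_interval F P x -> increasing F P x ->
    in_unit_interval (rat_seq (Phi F P x)) /\ converges_to F P x (Phi F P x).

(* Main.v *)
(** From a realiser to [exists^4]: given [Y], order all type 2 objects by
    [a <= b] iff [Y a = 0] implies [Y b = 0]. This total preorder is directed,
    and the net equal to 1 on the zeros of [Y] and to 0 elsewhere is increasing.
    Its limit is 1 or 0 according to whether [Y] has a zero, which a rational
    approximation of the limit decides.

    From [exists^4] to a realiser: [exists^4] decides, for natural numbers [k]
    and [m], whether the [m]-th rational approximation of some [x_a] with [a] in
    [E] is at least [k / 2^m]. The largest such [k <= 2^m], found by bounded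
    search, gives the supremum of the net up to about [2^-m]; as the net is
    increasing, this supremum is its limit. *)

From mathcomp Require Import all_boot all_order all_algebra.
From mathcomp Require Import zify lra.
From Stdlib Require Cantor.
Require Import Defs.

Set Implicit Arguments.
Unset Strict Implicit.
Unset Printing Implicit Defensive.
Import Order.TTheory GRing.Theory Num.Theory.

Definition v0 {G s} : term (s :: G) s := Var (VZ G s).
Definition v1 {G s r} : term (r :: s :: G) s := Var (VS r (VZ G s)).
Definition v2 {G s r q} : term (q :: r :: s :: G) s :=
  Var (VS q (VS r (VZ G s))).
Definition v3 {G s r q p} : term (p :: q :: r :: s :: G) s :=
  Var (VS p (VS q (VS r (VZ G s)))).
Definition v4 {G s r q p o} : term (o :: p :: q :: r :: s :: G) s :=
  Var (VS o (VS p (VS q (VS r (VZ G s))))).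
Definition v5 {G s r q p o n} : term (n :: o :: p :: q :: r :: s :: G) s :=
  Var (VS n (VS o (VS p (VS q (VS r (VZ G s)))))).

Local Notation "f · x" := (App f x) (at level 40, left associativity).

Fixpoint tnum {G} (n : nat) : term G Nat :=
  if n is n'.+1 then Succ _ · tnum n' else Zero _.

Definition tadd {G} : term G (Nat ~> Nat ~> Nat) :=
  Lam (Lam (Rec _ Nat · v1 · Lam (Lam (Succ _ · v0)) · v0)).

Lemma eval_tadd G (rho : env G) m n : eval tadd rho m n = (m + n)%N.
Proof. by elim: n => [|n IHn]; rewrite ?addn0 // addnS -IHn. Qed.
Opaque tadd.

Definition tpred {G} : term G (Nat ~> Nat) :=
  Lam (Rec _ Nat · Zero _ · Lam (Lam v1) · v0).

Lemma eval_tpred G (rho : env G) n : eval tpred rho n = n.-1.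
Proof. by case: n. Qed.
Opaque tpred.

Definition tsub {G} : term G (Nat ~> Nat ~> Nat) :=
  Lam (Lam (Rec _ Nat · v1 · Lam (Lam (tpred · v0)) · v0)).

Lemma eval_tsub G (rho : env G) m n : eval tsub rho m n = (m - n)%N.
Proof.
elim: n => [|n IHn] /=; first by rewrite subn0.
by rewrite eval_tpred subnS -IHn.
Qed.
Opaque tsub.

Definition tmul {G} : term G (Nat ~> Nat ~> Nat) :=
  Lam (Lam (Rec _ Nat · Zero _ · Lam (Lam (tadd · v3 · v0)) · v0)).

Lemma eval_tmul G (rho : env G) m n : eval tmul rho m n = (m * n)%N.
Proof.
elim: n => [|n IHn] /=; first by rewrite muln0.
by rewrite eval_tadd mulnS -IHn.
Qed.
Opaque tmul.

Definition tpow2 {G} : term G (Nat ~> Nat) :=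
  Lam (Rec _ Nat · tnum 1 · Lam (Lam (tadd · v0 · v0)) · v0).

Lemma eval_tpow2 G (rho : env G) n : eval tpow2 rho n = (2 ^ n)%N.
Proof.
elim: n => //= n IHn; rewrite eval_tadd expnS mul2n -addnn.
by congr (_ + _)%N.
Qed.
Opaque tpow2.

Definition todd {G} : term G (Nat ~> Nat) :=
  Lam (Rec _ Nat · Zero _ · Lam (Lam (tsub · tnum 1 · v0)) · v0).

Lemma eval_todd G (rho : env G) n : eval todd rho n = odd n.
Proof.
elim: n => //= n IHn; rewrite eval_tsub.
by move: IHn => /= ->; case: (odd n).
Qed.
Opaque todd.

Definition tifz {G} : term G (Nat ~> Nat ~> Nat ~> Nat) :=
  Lam (Lam (Lam (Rec _ Nat · v1 · Lam (Lam v2) · v2))).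

Lemma eval_tifz G (rho : env G) n u v :
  eval tifz rho n u v = if n is 0 then u else v.
Proof. by case: n. Qed.
Opaque tifz.

Definition tpair {G} : term G (Nat ~> Nat ~> Nat) :=
  Lam (Lam (tadd · v0 ·
    (Rec _ Nat · Zero _ · Lam (Lam (tadd · (Succ _ · v1) · v0)) ·
      (tadd · v0 · v1)))).

Lemma eval_tpair G (rho : env G) a b :
  eval tpair rho a b = Cantor.to_nat (a, b).
Proof.
rewrite /= !eval_tadd; congr (_ + _)%N.
rewrite plusE; elim: (b + a)%N => //= n ->.
by rewrite eval_tadd.
Qed.
Opaque tpair.

(* The decoded pair [(a, b)] is a function sending 0 to [a] and all other
   arguments to [b]. *)
Definition tunpair {G} : term G (Nat ~> Nat ~> Nat) :=
  Lam (Rec _ (Nat ~> Nat) · Lam (Zero _) ·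
    Lam (Lam (Lam (tifz · v0 ·
      (tifz · (v1 · Zero _) · (Succ _ · (v1 · tnum 1))
                            · (tpred · (v1 · Zero _))) ·
      (tifz · (v1 · Zero _) · Zero _ · (Succ _ · (v1 · tnum 1)))))) · v0).

Lemma eval_tunpair G (rho : env G) c i :
  eval tunpair rho c i =
  if i is 0 then (Cantor.of_nat c).1 else (Cantor.of_nat c).2.
Proof.
elim: c i => [|c IHc] i; first by case: i.
have /= IHc0 := IHc 0%N; have /= IHc1 := IHc 1%N.
rewrite /= !eval_tifz eval_tpred !IHc0 IHc1.
by case: (Cantor.of_nat c) => -[|a] b; case: i.
Qed.
Opaque tunpair.

(* If [c] codes the pair [(a, b)], then [rat_of_code c >= k / 2 ^ m] iff [a] is
   even and [2 k (b + 1) <= a 2 ^ m]. *)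
Definition trat_ge {G} : term G (Nat ~> Nat ~> Nat ~> Nat) :=
  Lam (Lam (Lam (tadd · (todd · (tunpair · v2 · Zero _)) ·
    (tsub · (tmul · (tmul · v1 · (Succ _ · (tunpair · v2 · tnum 1))) · tnum 2)
          · (tmul · (tunpair · v2 · Zero _) · (tpow2 · v0)))))).

Local Open Scope ring_scope.

Lemma eval_trat_ge G (rho : env G) c k m :
  eval trat_ge rho c k m = 0%N <-> k%:R / 2 ^+ m <= rat_of_code c.
Proof.
apply: (iff_trans (rwP eqP)).
rewrite /= eval_tadd eval_tsub eval_todd !eval_tmul eval_tpow2 !eval_tunpair.
rewrite addn_eq0 /rat_of_code; case: (Cantor.of_nat c) => a b /=.
have p2_gt0 : 0 < 2 ^+ m :> rat by rewrite exprn_gt0.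
case: ifP => odd_a /=.
  split=> //; rewrite leNgt => /negP[]; apply: lt_le_trans (_ : 0 <= _).
    by rewrite mulNr oppr_lt0 divr_gt0 ?ltr0Sn // ltr0n; case: a odd_a.
  by rewrite divr_ge0 // ltW.
rewrite ler_pdivrMr // mulrAC ler_pdivlMr ?ltr0Sn // -natrX -!natrM ler_nat.
rewrite -{1}[a]odd_double_half odd_a add0n subn_eq0 muln2 -doubleMl leq_double.
by [].
Qed.
Opaque trat_ge.

Lemma rat_of_to_nat k d :
  rat_of_code (Cantor.to_nat (k.*2, d)) = k%:R / d.+1%:R.
Proof. by rewrite /rat_of_code Cantor.cancel_of_to odd_double doubleK. Qed.

Lemma expr2n_gt0 n : 0 < 2 ^+ n :> rat.
Proof. by rewrite exprn_gt0. Qed.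

Lemma expr2n_inv_gt0 n : 0 < 2 ^- n :> rat.
Proof. by rewrite invr_gt0 expr2n_gt0. Qed.

Lemma expr2n_inv_le m n : (m <= n)%N -> 2 ^- n <= 2 ^- m :> rat.
Proof. by move=> le_mn; rewrite lef_pV2 ?posrE ?expr2n_gt0 // ler_weXn2l. Qed.

Lemma is_real_dist q m n k :
  is_real q -> (k <= m)%N -> (k <= n)%N -> `|q m - q n| < 2 ^- k.
Proof.
move=> q_real; wlog le_mn : m n / (m <= n)%N => [IH|] le_km le_kn.
  by case/orP: (leq_total m n) => ?; [|rewrite distrC]; apply: IH.
have := q_real m (n - m)%N; rewrite subnKC // => /lt_le_trans; apply.
exact: expr2n_inv_le.
Qed.

Definition texists4 : closed_term (mct_type ~> pure 4) :=
  Lam (Lam (trat_ge ·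
    (v1 · Lam (tnum 1)
        · Lam (Lam (tsub · tnum 1 ·
            (tmul · (v2 · v0) · (tsub · tnum 1 · (v2 · v1)))))
        · Lam (Lam (tmul · tnum 3 · (tsub · tnum 1 · (v2 · v1))))
        · tnum 3) · tnum 1 · tnum 1)).

(* The relation and the net are specified pointwise, as the values of the terms
   in [texists4] agree with these formulas only up to functional extensionality.
   The numbers 0 and 3 code the rationals 0 and 1. *)
Section ZeroNet.
Context (Y : obj (pure 3)) (P : obj (pure 2 ~> pure 2 ~> pure 0)).
Context (x : obj (pure 2 ~> pure 1)).
Hypothesis PE : forall a b, P a b = (1 - Y b * (1 - Y a))%N.
Hypothesis xE : forall a n, x a n = (3 * (1 - Y a))%N.

Lemma in_zero_relP a b : in_rel P a b <-> (Y a = 0%N -> Y b = 0%N).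
Proof.
rewrite /in_rel PE.
by case: (Y a) (Y b) => [|i] [|j]; split=> // h; rewrite ?muln0 //;
  have := h erefl.
Qed.

Lemma rat_seq_zero_net a n : rat_seq (x a) n = (Y a == 0%N)%:R.
Proof. by rewrite /rat_seq xE; case: (Y a). Qed.

Lemma zero_netP :
  net_in_unit_interval (fun=> 1%N) P x /\
  increasing (fun=> 1%N) P x.
Proof.
have p0 n : 0 <= 2 / 2 ^+ n :> rat by rewrite divr_ge0 // exprn_ge0.
split; last first.
  move=> a b _ _ /in_zero_relP hab n; rewrite !rat_seq_zero_net.
  apply: ler_wpDr => //; rewrite ler_nat.
  by case: eqP => // /hab ->.
split.
- by split=> // a b; rewrite PE leq_subr.
- split=> //.
  + by exists (fun=> 0%N).
  + move=> a b c _ _ _ /in_zero_relP hab /in_zero_relP hbc.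
    by apply/in_zero_relP => /hab.
  + by move=> a _; apply/in_zero_relP.
  + move=> a b _ _; case: (eqVneq (Y a) 0%N) => Ya.
      by exists a; split=> //; apply/in_zero_relP.
    by exists b; split=> //; apply/in_zero_relP => // /eqP; rewrite (negPf Ya).
- move=> a _; split=> [n i|n|n]; rewrite /real_rat !rat_seq_zero_net.
  + by rewrite subrr normr0 expr2n_inv_gt0.
  + by rewrite addr_ge0.
  + by rewrite ler_wpDr //; case: eqP.
Qed.

Lemma zero_net_limit_ge_half (Phi : obj mct_type) :
  mct_net1_realiser Phi ->
  1%:R / 2 ^+ 1 <= rat_seq (Phi (fun=> 1%N) P x) 3 <->
  exists f, Y f = 0%N.
Proof.
move=> PhiP; have [netY incY] := zero_netP.
have [[]] := PhiP _ _ _ netY incY.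
set y := Phi _ _ _ => y_real _ _ y_lim.
set eps : obj (pure 1) := fun=> Cantor.to_nat (1.*2, 3%N).
have epsE n : rat_seq eps n = 1 / 4 by rewrite /rat_seq rat_of_to_nat.
have [||e0 _ e0P] := y_lim eps.
- by move=> n i; rewrite !epsE subrr normr0 expr2n_inv_gt0.
- by exists 4; rewrite epsE.
have y3 e : in_rel P e0 e ->
    `|(Y e == 0%N)%:R - rat_seq y 3| < 3%:R / 8%:R.
  move=> /(e0P e erefl)[n].
  rewrite epsE /real_abs /real_sub rat_seq_zero_net => lt_n.
  have n_ge3 : (3 <= n)%N.
    rewrite leqNgt; apply/negP => n_lt3.
    have := expr2n_inv_le (n_lt3 : (n <= 2)%N).
    have := normr_ge0 ((Y e == 0%N)%:R - rat_seq y n.+1).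
    by lra.
  have := is_real_dist y_real (leqnn 3) (leqW n_ge3).
  have := expr2n_inv_gt0 n.
  move: lt_n; rewrite -ltrBrDr !ltr_norml => /andP[? ?] ? /andP[? ?].
  by apply/andP; split; lra.
split=> [y3_ge|[f Yf]].
  exists e0; have /y3 : in_rel P e0 e0 by apply/in_zero_relP.
  rewrite ltr_norml; case: eqP => // _ /=.
  by move=> /andP[? ?]; exfalso; lra.
have /y3 : in_rel P e0 f by apply/in_zero_relP.
by rewrite Yf ltr_norml eqxx /= => /andP[? ?]; lra.
Qed.
End ZeroNet.

(* The largest [k <= 2 ^ m] such that [k / 2 ^ m] is at most the [m]-th
   approximation of some value of the net, and 0 if there is none. *)
Definition tsup {G} :
    term G (pure 4 ~> pure 3 ~> (pure 2 ~> pure 1) ~> Nat ~> Nat) :=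
  Lam (Lam (Lam (Lam (Rec _ Nat · Zero _ ·
    Lam (Lam (tifz ·
      (v5 · Lam (tadd · (tsub · tnum 1 · (v5 · v0)) ·
                   (trat_ge · (v4 · v0 · v3) · (Succ _ · v2) · v3))) ·
      (Succ _ · v1) · v0)) ·
    (tpow2 · v0))))).

Definition tmct : closed_term (pure 4 ~> mct_type) :=
  Lam (Lam (Lam (Lam (Lam (tpair ·
    (tmul · (tsup · v4 · v3 · v1 · (Succ _ · v0)) · tnum 2) ·
    (tpred · (tpow2 · (Succ _ · v0)))))))).

Definition attained (F : obj (pure 3)) (x : obj (pure 2 ~> pure 1)) m k :=
  exists2 a, in_set F a & k%:R / 2 ^+ m <= rat_seq (x a) m.

Definition sup_approx F x m K :=
  [/\ (K <= 2 ^ m)%N, K = 0%N \/ attained F x m K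
    & forall k, (K < k <= 2 ^ m)%N -> ~ attained F x m k].

Lemma eval_tsup G (rho : env G) (E : obj (pure 4)) (F : obj (pure 3))
    (x : obj (pure 2 ~> pure 1)) m :
  is_exists4 E -> (forall a, F a <= 1)%N ->
  sup_approx F x m (eval tsup rho E F x m).
Proof.
move=> E_ex F_le1; rewrite /sup_approx /= eval_tpow2.
set step := (X in nat_rect _ _ X _).
have stepE k r : (step k r = k.+1 /\ attained F x m k.+1) \/
                 (step k r = r /\ ~ attained F x m k.+1).
  rewrite /step eval_tifz; set Z := (X in E X).
  have ZE : E Z = 0%N <-> attained F x m k.+1.
    apply: iff_trans (E_ex Z) _; split=> [[a]|[a aF le_a]].
      rewrite /Z eval_tadd eval_tsub => /eqP.
      rewrite addn_eq0 => /andP[Fa /eqP].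
      move/eval_trat_ge => le_a; exists a => //; apply/eqP.
      by rewrite eqn_leq F_le1 -subn_eq0.
    exists a; rewrite /Z eval_tadd eval_tsub aF subnn add0n.
    by apply/eval_trat_ge.
  by case: (E Z) ZE => [|j] [h1 h2]; [left | right]; split; auto => /h2.
elim: (2 ^ m)%N => [|B [leB attB maxB]] /=.
  by split=> //; [left | case=> // k; rewrite ltn0 andbF].
set r := nat_rect _ _ _ _ in leB attB maxB *.
case: (stepE B r) => -[-> att]; split=> //; [by right | | exact: leqW |].
  by move=> k /andP[/leq_trans h /h]; rewrite ltnn.
move=> k; rewrite [(k <= _)%N]leq_eqVlt ltnS andb_orr.
move=> /orP[/andP[_ /eqP->] //|].
exact: maxB.
Qed.
Opaque tsup.

Section SupApprox.
Context (F : obj (pure 3)) (P : obj (pure 2 ~> pure 2 ~> pure 0)).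
Context (x : obj (pure 2 ~> pure 1)).
Hypotheses (netx : net_in_unit_interval F P x) (incx : increasing F P x).

Lemma sup_approx_lt m K a : sup_approx F x m K -> in_set F a ->
  K = (2 ^ m)%N \/ rat_seq (x a) m < K.+1%:R / 2 ^+ m.
Proof.
move=> [le_K _ maxK] aF; case: (ltnP K (2 ^ m)) => K2; last first.
  by left; apply/eqP; rewrite eqn_leq le_K.
right; rewrite ltNge; apply/negP => le_a.
by apply: (maxK K.+1); [rewrite ltnSn | exists a].
Qed.

Lemma sup_approx_ub m K a : sup_approx F x m K -> in_set F a ->
  rat_seq (x a) m <= (K%:R + 2) / 2 ^+ m.
Proof.
move=> Ksup aF; have [_ _ /(_ a aF)[_ _ /(_ m)]] := netx.
have p_gt0 := expr2n_gt0 m.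
case: (sup_approx_lt Ksup aF) => [->|/ltW].
  by rewrite natrX [X in _ -> _ <= X]mulrDl divff ?gt_eqF.
move=> /le_trans h _; apply: h; apply: ler_wpM2r; first by rewrite invr_ge0 ltW.
by rewrite -natrD ler_nat addn2.
Qed.

Lemma sup_approx_lb m K : sup_approx F x m K ->
  exists2 e0, in_set F e0 & forall e, in_set F e -> in_rel P e0 e ->
    (K%:R - 2) / 2 ^+ m <= rat_seq (x e) m.
Proof.
have [_ [[a aF] _ _ _] unitx] := netx.
move=> [_ [->|[e0 e0F le_e0]] _].
  exists a => // e /unitx[_ /(_ m) e_ge0 _] _.
  by rewrite sub0r mulNr lerNl -subr_ge0 opprK addrC.
exists e0 => // e eF /(incx e0F eF)/(_ m)/(le_trans le_e0).
by rewrite mulrBl lerBlDr.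
Qed.

Lemma sup_approx_dist m K m' K' k :
  sup_approx F x m K -> sup_approx F x m' K' -> (k <= m)%N -> (k <= m')%N ->
  K%:R / 2 ^+ m - K'%:R / 2 ^+ m' < 2 * 2 ^- k :> rat.
Proof.
move=> [leK attK _] Ksup' le_km le_km'.
have p_gt0 := expr2n_gt0 m; have p'_gt0 := expr2n_gt0 m'.
have k_gt0 := expr2n_inv_gt0 k.
have K'_ge0 : 0 <= K'%:R / 2 ^+ m' :> rat by rewrite divr_ge0 // ltW.
case: attK => [->|[a aF le_a]]; first by rewrite mul0r; lra.
case: (sup_approx_lt Ksup' aF) => [->|lt_a].
  have K_le1 : K%:R / 2 ^+ m <= 1 :> rat.
    by rewrite ler_pdivrMr // mul1r -natrX ler_nat.
  by rewrite natrX divff ?gt_eqF //; lra.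
have [_ _ /(_ a aF)[a_real _ _]] := netx.
have := is_real_dist a_real le_km le_km'; rewrite ltr_norml => /andP[_].
have := expr2n_inv_le le_km'.
by move: lt_a; rewrite -addn1 natrD mulrDl mul1r; lra.
Qed.

Lemma sup_approx_limit (y : obj (pure 1)) (k : nat -> nat) :
  (forall n, sup_approx F x n.+1 (k n)) ->
  (forall n, rat_seq y n = (k n)%:R / 2 ^+ n.+1) ->
  in_unit_interval (rat_seq y) /\ converges_to F P x y.
Proof.
move=> ksup yE.
have p_gt0 n := expr2n_gt0 n; have p_inv_gt0 n := expr2n_inv_gt0 n.
have p_halve n : 2 ^- n = 2 * 2 ^- n.+1 :> rat.
  by rewrite exprS invfM mulrA divff // mul1r.
split; first split.
- move=> n i; rewrite !yE ltr_norml (p_halve n) ltrNl opprB.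
  by rewrite !sup_approx_dist ?ltnS ?leq_addr.
- move=> n; rewrite yE /real_rat addr_ge0 // divr_ge0 //; exact: ltW.
- move=> n; rewrite yE /real_rat; apply: ler_wpDr.
    by rewrite divr_ge0 // ltW.
  by rewrite ler_pdivrMr // mul1r -natrX ler_nat; case: (ksup n).
move=> eps eps_real [n]; rewrite /real_rat add0r => lt_eps.
have [e0 e0F lb] := sup_approx_lb (ksup n.+3).
exists e0 => // e eF e0e; exists n.+2.
have [_ _ /(_ e eF)[e_real _ _]] := netx.
rewrite /real_abs /real_sub yE -ltrBrDr.
have := lb e eF e0e; have := sup_approx_ub (ksup n.+3) eF.
have := is_real_dist e_real (leqnn n.+3) (leqnSn n.+3).
have := is_real_dist eps_real (leqnn n) (leqW (leqnSn n)).
move: lt_eps (p_inv_gt0 n).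
rewrite !mulrBl !mulrDl !(p_halve n) !(p_halve n.+1) !(p_halve n.+2).
rewrite !(p_halve n.+3) !ltr_norml.
move=> ? ? /andP[? ?] /andP[? ?] ? ?; apply/andP; split; lra.
Qed.
End SupApprox.

Lemma tmct_realiser (E : obj (pure 4)) :
  is_exists4 E -> mct_net1_realiser (value tmct E).
Proof.
move=> E_ex F P x netx incx; have [[F_le1 _] _ _] := netx.
pose G := [:: Nat; pure 2 ~> pure 1; pure 2 ~> pure 2 ~> pure 0;
              pure 3; pure 4]%fty.
pose k n := eval (tsup (G := G)) (n, (x, (P, (F, (E, tt))))) E F x n.+1.
apply: (sup_approx_limit (k := k) netx incx) => n; first exact: eval_tsup.
rewrite /rat_seq /value /= eval_tpair eval_tmul eval_tpred eval_tpow2.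
by rewrite muln2 rat_of_to_nat prednK ?expn_gt0 // natrX.
Qed.

Lemma texists4_correct (Phi : obj mct_type) :
  mct_net1_realiser Phi -> is_exists4 (value texists4 Phi).
Proof.
move=> PhiP Y; rewrite /value /=.
apply: iff_trans (eval_trat_ge _ _ 1 1) _.
apply: zero_net_limit_ge_half => // [a b|a n].
  by rewrite eval_tsub eval_tmul eval_tsub.
by rewrite eval_tmul eval_tsub.
Qed.

Theorem theoremA3 :
  (exists t : closed_term (mct_type ~> pure 4),
     forall Phi : obj mct_type,
       mct_net1_realiser Phi -> is_exists4 (value t Phi)) /\
  (exists s : closed_term (pure 4 ~> mct_type),
     forall E : obj (pure 4),
       is_exists4 E -> mct_net1_realiser (value s E)).
Proof.
split; first by exists texists4; exact: texists4_correct.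
by exists tmct; exact: tmct_realiser.
Qed.
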